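(* For any graph $H$ and any $n\in\mathbb{N}$ with $n\geq 1$, $$\mathrm{exsat_p}(H,H[n])\leq (2n-1)\,e(H).$$
   Context: Graphs are finite and simple; $e(H)$ is the number of edges of $H$. For a graph $H$ and $n\in\mathbb{N}$, $H[n]$ is the graph obtained from $H$ by replacing each vertex with an independent set (a part) of size $n$ and each edge with a complete bipartite graph between the corresponding parts. A copy of $H$ in $H[n]$ is partite if it has exactly one vertex in each part of $H[n]$. A spanning subgraph $G\subseteq H[n]$ is $(H,H[n])$-partite-extra-saturated if for every edge $uv\in E(H[n])\setminus E(G)$ the graph $G\cup uv$ has more partite copies of $H$ than $G$ ($G$ itself is allowed to contain partite copies of $H$). $\mathrm{exsat_p}(H,H[n])$ is the minimum of $e(G)$ over all $(H,H[n])$-partite-extra-saturated graphs $G$. *)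

(* Defs.v *)
From mathcomp Require Import all_boot.

Set Implicit Arguments.
Unset Strict Implicit.
Unset Printing Implicit Defensive.

(* A graph whose vertex set is the whole finite type T is given by its edge
   set, a set of 2-element subsets of T; e(E) is then #|E|. *)
Definition simple_graph (T : finType) (E : {set {set T}}) : bool :=
  [forall a in E, #|a| == 2].

(* H[n]: the part of the vertex v is {v} x 'I_n. *)
Definition blowup (V : finType) (H : {set {set V}}) (n : nat) :
    {set {set V * 'I_n}} :=
  [set [set x; y] | x in [set: V * 'I_n], y in [set: V * 'I_n]
                  & [set x.1; y.1] \in H].

(* C = (vertex set, edge set) is a subgraph of G isomorphic to H: the
   injection f witnesses the isomorphism from H onto C.  Copies are thus
   counted as subgraphs, not as embeddings. *)
Definition is_copy (V T : finType) (H : {set {set V}}) (G : {set {set T}})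
    (C : {set T} * {set {set T}}) : bool :=
  (C.2 \subset G) &&
  [exists f : {ffun V -> T},
     [&& injectiveb f, C.1 == [set f v | v : V]
       & C.2 == [set [set f v | v in a] | a : {set V} in H]]].

Definition partite (V : finType) (n : nat) (S : {set V * 'I_n}) : bool :=
  [forall v : V, #|[set x in S | x.1 == v]| == 1].

Definition partite_copies (V : finType) (H : {set {set V}}) (n : nat)
    (G : {set {set V * 'I_n}}) : {set {set V * 'I_n} * {set {set V * 'I_n}}} :=
  [set C | is_copy H G C & partite C.1].

Definition partite_extra_saturated (V : finType) (H : {set {set V}}) (n : nat)
    (G : {set {set V * 'I_n}}) : bool :=
  (G \subset blowup H n) &&
  [forall a in blowup H n :\: G,
     #|partite_copies H G| < #|partite_copies H (a |: G)|].

Lemma blowup_extra_saturated (V : finType) (H : {set {set V}}) (n : nat) :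
  partite_extra_saturated H (blowup H n).
Proof.
rewrite /partite_extra_saturated subxx /=.
by apply/forall_inP => a; rewrite setDv inE.
Qed.

(* The minimum is taken over a nonempty family, by blowup_extra_saturated. *)
Definition exsatp (V : finType) (H : {set {set V}}) (n : nat) : nat :=
  #|[arg min_(G < blowup H n | partite_extra_saturated H G) #|G|]|.

Lemma exsatp_attained (V : finType) (H : {set {set V}}) (n : nat) :
  exists2 G : {set {set V * 'I_n}},
    partite_extra_saturated H G & #|G| = exsatp H n.
Proof.
rewrite /exsatp; case: arg_minnP => [|G satG _]; last by exists G.
exact: blowup_extra_saturated.
Qed.

Lemma exsatp_min (V : finType) (H : {set {set V}}) (n : nat)
    (G : {set {set V * 'I_n}}) :
  partite_extra_saturated H G -> exsatp H n <= #|G|.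
Proof.
move=> satG; rewrite /exsatp; case: arg_minnP => [|G0 _ minG0].
  exact: blowup_extra_saturated.
exact: minG0.
Qed.

(* Main.v *)
Require Import Defs.
From mathcomp Require Import all_boot.

(** Call a vertex of H[n] central if its index is 0, so that every part has
    exactly one central vertex, and let G consist of the edges of H[n] that
    have a central end.

    G is partite-extra-saturated: a missing edge e joins non-central vertices x
    and y of two parts.  The transversal that takes x and y in their parts and
    the central vertex in every other part spans a partite copy of H in which e
    is the only edge without a central end.  That copy lies in G with e added,
    but not in G (lemma [hub_saturated]).

    Over each edge of H, exactly n^2 - (n-1)^2 = 2n - 1 edges of H[n] have a
    central end: one with both ends central, and n - 1 for each choice of a
    non-central end (lemma [card_hub] gives the upper bound). *)

Set Implicit Arguments.
Unset Strict Implicit.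
Unset Printing Implicit Defensive.

Lemma mem_blowup (V : finType) (H : {set {set V}}) (n : nat)
    (x y : V * 'I_n) :
  [set x.1; y.1] \in H -> [set x; y] \in blowup H n.
Proof. by move=> xyH; apply/imset2P; exists x y; rewrite ?inE. Qed.

Lemma blowupP (V : finType) (H : {set {set V}}) (n : nat)
    (e : {set V * 'I_n}) :
  reflect (exists x y, [set x.1; y.1] \in H /\ e = [set x; y])
          (e \in blowup H n).
Proof.
apply: (iffP idP) => [/imset2P[x y _]|[x [y [xyH ->]]]]; last exact: mem_blowup.
by rewrite !inE => xyH ->; exists x, y.
Qed.

Lemma simple_graph_neq (V : finType) (H : {set {set V}}) (u v : V) :
  simple_graph H -> [set u; v] \in H -> u != v.
Proof. by move=> /forall_inP hH /hH; rewrite cards2; case: (u != v). Qed.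

Section Transversal.

Variables (V : finType) (n : nat) (g : V -> 'I_n).

Definition transversal (v : V) : V * 'I_n := (v, g v).

Definition transversal_copy (H : {set {set V}}) :
    {set V * 'I_n} * {set {set V * 'I_n}} :=
  ([set transversal v | v : V], [set transversal @: a | a : {set V} in H]).

Lemma transversal_inj : injective transversal.
Proof. by move=> u v []. Qed.

Lemma transversal_partite : partite [set transversal v | v : V].
Proof.
apply/forallP => v; apply/cards1P; exists (transversal v).
apply/setP => x; rewrite !inE; apply/andP/eqP => [[/imsetP[w _ ->] /eqP /= ->]//|->].
by rewrite imset_f.
Qed.

Lemma transversal_copyP (H : {set {set V}}) (G : {set {set V * 'I_n}}) :
  (transversal_copy H \in partite_copies H G)
    = ([set transversal @: a | a : {set V} in H] \subset G).
Proof.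
rewrite inE transversal_partite andbT /is_copy /=.
apply/andP/idP => [[]//|sub]; split=> //.
apply/existsP; exists (finfun transversal).
have eq_im (A : {set V}) : finfun transversal @: A = transversal @: A.
  by apply: eq_imset => v; rewrite ffunE.
apply/and3P; split.
- by apply/injectiveP => u v; rewrite !ffunE => /transversal_inj.
- by apply/eqP/eq_imset => v; rewrite ffunE.
- by apply/eqP/eq_imset => a; rewrite eq_im.
Qed.

End Transversal.

Lemma partite_copiesS (V : finType) (H : {set {set V}}) (n : nat)
    (G1 G2 : {set {set V * 'I_n}}) :
  G1 \subset G2 -> partite_copies H G1 \subset partite_copies H G2.
Proof.
move=> sG; apply/subsetP => C; rewrite !inE /is_copy => /andP[/andP[sC ->] ->].
by rewrite (subset_trans sC sG).
Qed.

Section Hub.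

Variables (V : finType) (H : {set {set V}}) (n : nat).
Hypothesis simpleH : simple_graph H.

Definition hub : {set {set V * 'I_n.+1}} :=
  [set e in blowup H n.+1 | [exists x in e, x.2 == ord0]].

Lemma hub_saturated : partite_extra_saturated H hub.
Proof.
apply/andP; split; first by apply/subsetP => e; rewrite inE => /andP[].
apply/forall_inP => e; rewrite !inE => /andP[e_nhub eB]; move: e_nhub; rewrite eB /=.
case/blowupP: eB => x [y [xyH ->{e}]].
rewrite negb_exists_in => /forall_inP nz.
have neq_xy := simple_graph_neq simpleH xyH.
pose g v := if v == x.1 then x.2 else if v == y.1 then y.2 else ord0.
have gx : transversal g x.1 = x by rewrite /transversal /g eqxx -surjective_pairing.
have gy : transversal g y.1 = y.
  by rewrite /transversal /g eq_sym (negbTE neq_xy) eqxx -surjective_pairing.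
have im_xy : transversal g @: [set x.1; y.1] = [set x; y].
  by rewrite imsetU1 imset_set1 gx gy.
apply: proper_card; apply/properP; split; first exact/partite_copiesS/subsetUr.
exists (transversal_copy g H); rewrite transversal_copyP; last first.
  apply/subsetPn; exists [set x; y]; first by rewrite -im_xy imset_f.
  by rewrite inE negb_and negb_exists_in; apply/orP; right; apply/forall_inP.
apply/subsetP => _ /imsetP[b bH ->]; rewrite 2!inE.
have [->|neq_b] := eqVneq b [set x.1; y.1]; first by rewrite im_xy eqxx.
have b2 : #|b| == 2 := forall_inP simpleH _ bH.
apply/orP; right; rewrite inE; apply/andP; split.
  case/cards2P: b2 bH => u [v [_ ->]] uvH.
  by rewrite imsetU1 imset_set1 mem_blowup.
(* As b and {x.1, y.1} are distinct of the same size, b has a vertex outside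
   {x.1, y.1}; there the transversal takes the central vertex. *)
have /subsetPn[w wb] : ~~ (b \subset [set x.1; y.1]).
  apply: contra neq_b => sb.
  by rewrite eqEcard sb cards2 neq_xy (eqP b2).
rewrite !inE negb_or => /andP[wx wy].
apply/exists_inP; exists (transversal g w); first exact: imset_f.
by rewrite /= /g (negbTE wx) (negbTE wy).
Qed.

(** The transversal through central vertices, except for index [i] in part
    [w].  Its image of an edge of H at [w] is an edge of [hub]. *)
Definition spoke (w : V) (i : 'I_n.+1) : V -> V * 'I_n.+1 :=
  transversal (fun v => if v == w then i else ord0).

(** Splitting off the edge with both ends central keeps it from being counted
    once for each end, which would give 2n instead of 2n - 1. *)
Definition hub_over (a : {set V}) : {set {set V * 'I_n.+1}} :=
  transversal (fun=> ord0) @: a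
    |: [set spoke w i @: a | w in a, i in [set~ ord0]].

Lemma card_hub_over (a : {set V}) : #|a| = 2 -> #|hub_over a| <= 2 * n.+1 - 1.
Proof.
move=> a2; rewrite cardsU1 curry_imset2X.
have := leq_imset_card (uncurry (fun w i => spoke w i @: a))
          (setX a [set~ ord0]).
rewrite cardsX a2 cardsC1 card_ord /= => le_im.
by rewrite mulnS addSn subn1 (leq_add (leq_b1 _)).
Qed.

Lemma mem_hub_over (x y : V * 'I_n.+1) :
  x.1 != y.1 -> x.2 = ord0 -> [set x; y] \in hub_over [set x.1; y.1].
Proof.
case: x y => [u i] [v j] /= neq_uv ->; rewrite inE.
have [->|nz_j] := eqVneq j ord0.
  by rewrite in_set1 imsetU1 imset_set1 eqxx.
apply/orP; right; apply/imset2P; exists v j; rewrite ?inE ?eqxx ?orbT //.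
by rewrite imsetU1 imset_set1 /spoke /transversal eqxx (negbTE neq_uv).
Qed.

Lemma hub_cover : hub \subset \bigcup_(a in H) hub_over a.
Proof.
apply/subsetP => e; rewrite inE => /andP[/blowupP[x [y [xyH ->]]]].
have neq_xy := simple_graph_neq simpleH xyH.
case/exists_inP => z zxy /eqP z0; apply/bigcupP; exists [set x.1; y.1] => //.
case/set2P: zxy z0 => ->; first exact: mem_hub_over.
by rewrite setUC [X in hub_over X]setUC; apply: mem_hub_over; rewrite eq_sym.
Qed.

Lemma card_hub : #|hub| <= (2 * n.+1 - 1) * #|H|.
Proof.
apply: leq_trans (subset_leq_card hub_cover) _.
rewrite mulnC -sum_nat_const.
elim/big_rec2: _ => [|a m U aH leUm]; first by rewrite cards0.
apply: leq_trans (leq_card_setU _ _) _.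
by rewrite leq_add // card_hub_over //; apply/eqP/(forall_inP simpleH).
Qed.

End Hub.

Theorem mainTheorem7 (V : finType) (H : {set {set V}}) (n : nat)
    (hH : simple_graph H) (hn : 1 <= n) :
  exsatp H n <= (2 * n - 1) * #|H|.
Proof.
case: n hn => // n _.
exact: leq_trans (exsatp_min (hub_saturated n hH)) (card_hub n hH).
Qed.
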